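(* Let $q$ be a prime power and let $n,m,h$ be integers with $m\geq 3$ and $2\leq h\leq n-3$. Let $U\subseteq\mathbb{F}_{q^n}^{m(h+1)}$ be an $h$-scattered $\mathbb{F}_q$-subspace obtained as a direct sum $U=U_1\oplus\cdots\oplus U_m$ of maximum $h$-scattered $\mathbb{F}_q$-subspaces $U_j$ of $\mathbb{F}_{q^n}^{h+1}$ (placed in the $j$-th block of $h+1$ coordinates), and let $\mathcal{C}$ be the associated MRD code. For $\mathbf{A}=(\alpha_1,\dots,\alpha_m)\in(\mathbb{F}_{q^n}^* )^m$ let $\mathcal{G}_{\mathbf{A},h}$ be the MRD code associated with $$V_{\mathbf{A},h}:=\{(\underline{x},\underline{x}^q,\dots,\underline{x}^{q^{h-1}},f_1(\underline{x}),\dots,f_m(\underline{x})):\underline{x}\in\mathbb{F}_{q^n}^m\},$$ where $f_i(\underline{x})=x_i^{q^h}+\alpha_{i+1}x_{i+1}^{q^{h+1}}$ for $i<m$ and $f_m(\underline{x})=x_m^{q^h}+\alpha_1x_1^{q^{h+1}}$. Write $\mathcal{A}$ for the set of $\mathbf{A}$ such that $K_{\mathbf{A}}:=\alpha_1^{q^{m-1}}\alpha_2\alpha_3^{q}\cdots\alpha_m^{q^{m-2}}$ is not a $(1+q+\cdots+q^{m-1})$-th power in $\mathbb{F}_{q^n}$, and $\mathcal{B}$ for the set of $\mathbf{A}\in\mathcal{A}$ such that $\Pi_{\delta+2}/\Pi_2$ is not a $(q^m-1)$-th power in $\mathbb{F}_{q^n}$ for any $\delta=1,\dots,m-1$, where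 $\Pi_i:=\alpha_i^{q^{m-1}}\alpha_{i-1}^{q^{m-2}}\cdots\alpha_{i+2}^{q}\alpha_{i+1}$ (indices modulo $m$ in $\{1,\dots,m\}$). Then: (1) if $n>(s+1)(h+1)$, then for every $s=2,\dots,m-2$ and every $\mathbf{A}\in\mathcal{B}$, $d_{s(h+1)}(\mathcal{G}_{\mathbf{A},h})>d_{s(h+1)}(\mathcal{C})$; (2) if $n>2h+2$, then for every $\mathbf{A}\in\mathcal{A}$, $d_{h+1}(\mathcal{G}_{\mathbf{A},h})>d_{h+1}(\mathcal{C})$; (3) for every $\mathbf{A}\in\mathcal{A}$, $d_{(m-1)(h+1)}(\mathcal{G}_{\mathbf{A},h})>d_{(m-1)(h+1)}(\mathcal{C})$.
   Context: For $\underline{x}=(x_1,\dots,x_m)$, $\underline{x}^{q^j}=(x_1^{q^j},\dots,x_m^{q^j})$. An $\mathbb{F}_q$-subspace $W$ of an $r$-dimensional $\mathbb{F}_{q^n}$-space $V$ is $h$-scattered if $\langle W\rangle_{\mathbb{F}_{q^n}}=V$ and every $h$-dimensional $\mathbb{F}_{q^n}$-subspace of $V$ meets $W$ in $\mathbb{F}_q$-dimension at most $h$; it is maximum if $\dim_{\mathbb{F}_q}W=rn/(h+1)$ (so each $U_j$ has dimension $n$ and $U$, $V_{\mathbf{A},h}$ have dimension $mn$). A $t$-dimensional $\mathbb{F}_q$-subspace $W\subseteq\mathbb{F}_{q^n}^k$ spanning $\mathbb{F}_{q^n}^k$ (a $[t,k]_{q^n/q}$ system) has an associated rank-metric code: choose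 an $\mathbb{F}_q$-basis $w_1,\dots,w_t$ of $W$, and take the $\mathbb{F}_{q^n}$-row space of the $k\times t$ matrix with columns $w_1,\dots,w_t$ (well defined up to equivalence). Its $\rho$-th generalized rank weight ($1\leq\rho\leq k$) is $d_\rho=t-\max\{\dim_{\mathbb{F}_q}(W\cap H): H\subseteq\mathbb{F}_{q^n}^k\ \mathbb{F}_{q^n}\text{-subspace},\ \dim_{\mathbb{F}_{q^n}}H=k-\rho\}$. For maximum $h$-scattered subspaces as here, the associated codes are MRD codes, i.e. codes with parameters $[t,k,d]$ satisfying $nk=\min\{n(t-d+1),t(n-d+1)\}$ in the rank metric $\omega_{\mathrm{rk}}(v)=\dim_{\mathbb{F}_q}\langle v_1,\dots,v_t\rangle_{\mathbb{F}_q}$. *)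

(* Defs.v *)
From HB Require Import structures.
From mathcomp Require Import all_boot all_order all_algebra all_fingroup all_field.
From mathcomp Require Import boolp.

Set Implicit Arguments.
Unset Strict Implicit.
Unset Printing Implicit Defensive.

Import GRing.Theory.
Local Open Scope ring_scope.

(* F plays the role of F_q, with q = #|F|, and L that of F_{q^n}, with
   n = \dim {:L}.  The space L^k carries two linear structures.  They are kept
   on two different types: {ffun 'I_k -> L} is a vector space over F (and its
   F-subspaces are the systems W), 'rV[L]_k is a vector space over L. *)

Section ScalarRestriction.
Variables (F : finFieldType) (L : fieldExtType F).

Definition to_row k (w : {ffun 'I_k -> L}) : 'rV[L]_k := \row_i w i.

Definition of_row k (v : 'rV[L]_k) : {ffun 'I_k -> L} := [ffun i => v 0 i].

Lemma to_rowK k : cancel (@to_row k) (@of_row k).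
Proof. by move=> w; apply/ffunP=> i; rewrite ffunE mxE. Qed.

Lemma of_rowK k : cancel (@of_row k) (@to_row k).
Proof. by move=> v; apply/rowP=> i; rewrite mxE ffunE. Qed.

Lemma to_row_linear k (a : F) (v w : {ffun 'I_k -> L}) :
  to_row (a *: v + w) = a%:A *: to_row v + to_row w.
Proof. by apply/rowP=> i; rewrite !mxE !ffunE mulr_algl. Qed.

Lemma of_row_linear k (a : F) (v w : 'rV[L]_k) :
  of_row (a%:A *: v + w) = a *: of_row v + of_row w.
Proof. by apply/ffunP=> i; rewrite !ffunE !mxE mulr_algl. Qed.

(* An L-subspace H of L^k regarded as an F-subspace, see mem_restrict. *)
Definition proj_defect k (H : {vspace 'rV[L]_k}) (w : {ffun 'I_k -> L}) :=
  of_row (to_row w - projv H (to_row w)).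

Fact proj_defect_linear k (H : {vspace 'rV[L]_k}) : linear (proj_defect H).
Proof.
move=> a v w; rewrite /proj_defect to_row_linear linearP /= opprD addrACA.
by rewrite -scalerBr of_row_linear.
Qed.

HB.instance Definition _ k (H : {vspace 'rV[L]_k}) :=
  GRing.isLinear.Build F {ffun 'I_k -> L} {ffun 'I_k -> L} *:%R
    (proj_defect H) (proj_defect_linear H).

Definition restrict k (H : {vspace 'rV[L]_k}) : {vspace {ffun 'I_k -> L}} :=
  lker (linfun (proj_defect H)).

Lemma mem_restrict k (H : {vspace 'rV[L]_k}) w :
  (w \in restrict H) = (to_row w \in H).
Proof.
rewrite memv_ker lfunE /= /proj_defect; apply/eqP/idP => [e|wH].
  have /eqP : to_row w - projv H (to_row w) = 0.
    by rewrite -[LHS]of_rowK e; apply/rowP=> i; rewrite !mxE ffunE.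
  by rewrite subr_eq0 => /eqP->; apply: memv_proj.
by rewrite projv_id // subrr; apply/ffunP=> i; rewrite !ffunE mxE.
Qed.

End ScalarRestriction.

Section Scattered.
Variables (F : finFieldType) (L : fieldExtType F) (k : nat).

Definition ext_span (W : {vspace {ffun 'I_k -> L}}) : {vspace 'rV[L]_k} :=
  <<[seq to_row w | w <- vbasis W]>>%VS.

Definition scattered (h : nat) (W : {vspace {ffun 'I_k -> L}}) : Prop :=
  ext_span W = fullv /\
  forall H : {vspace 'rV[L]_k},
    \dim H = h -> (\dim (W :&: restrict H) <= h)%N.

Definition maximum_scattered (h : nat) (W : {vspace {ffun 'I_k -> L}}) : Prop :=
  scattered h W /\ (\dim W * h.+1 = k * \dim {:L})%N.

End Scattered.

Section Codes.
Variables (F : finFieldType) (L : fieldExtType F).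

Definition row_space k t (G : 'M[L]_(k, t)) : {vspace 'rV[L]_t} :=
  <<[seq row i G | i <- enum 'I_k]>>%VS.

Definition associated_code k (W : {vspace {ffun 'I_k -> L}})
    (C : {vspace 'rV[L]_(\dim W)}) : Prop :=
  exists2 w : (\dim W).-tuple {ffun 'I_k -> L},
    basis_of W w & C = row_space (\matrix_(i < k, j < \dim W) tnth w j i).

Definition max_meet k (W : {vspace {ffun 'I_k -> L}}) (r : nat) : nat :=
  \max_(d < (\dim W).+1 |
      `[< exists2 H : {vspace 'rV[L]_k},
            \dim H = r & \dim (W :&: restrict H) = d >]) d.

Definition system_weight k (W : {vspace {ffun 'I_k -> L}}) (rho : nat) : nat :=
  (\dim W - max_meet W (k - rho))%N.

(* The F-span of the columns of a generator matrix of C, whose choice is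
   immaterial by gen_rank_weightE. *)
Definition code_system t (C : {vspace 'rV[L]_t}) :
    {vspace {ffun 'I_(\dim C) -> L}} :=
  <<[seq [ffun i : 'I_(\dim C) => tnth (vbasis C) i ord0 j] | j <- enum 'I_t]>>%VS.

Definition gen_rank_weight t (C : {vspace 'rV[L]_t}) (rho : nat) : nat :=
  system_weight (code_system C) rho.

End Codes.

Arguments associated_code {F L k} W C.

Section ChangeOfGenerator.
Variables (F : finFieldType) (L : fieldExtType F).

Definition row_act k k' (P : 'M[L]_(k, k')) (w : {ffun 'I_k -> L}) :
  {ffun 'I_k' -> L} := of_row (to_row w *m P).

Fact row_act_linear k k' (P : 'M[L]_(k, k')) : linear (row_act P).
Proof.
by move=> a v w; rewrite /row_act to_row_linear mulmxDl -scalemxAl of_row_linear.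
Qed.

HB.instance Definition _ k k' (P : 'M[L]_(k, k')) :=
  GRing.isLinear.Build F {ffun 'I_k -> L} {ffun 'I_k' -> L} *:%R
    (row_act P) (row_act_linear P).

Lemma row_actK k k' (P : 'M[L]_(k, k')) (Q : 'M[L]_(k', k)) :
  P *m Q = 1%:M -> cancel (row_act P) (row_act Q).
Proof. by move=> e w; rewrite /row_act of_rowK -mulmxA e mulmx1 to_rowK. Qed.

Lemma dim_img_inj (K : fieldType) (aT rT : vectType K) (f : 'Hom(aT, rT)) U :
  injective f -> \dim (f @: U) = \dim U.
Proof. by move=> /lker0P/eqP e; rewrite limg_dim_eq // e capv0. Qed.

Lemma img_cap_inj (K : fieldType) (aT rT : vectType K) (f : 'Hom(aT, rT)) U V :
  injective f -> (f @: (U :&: V) = f @: U :&: f @: V)%VS.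
Proof.
move=> fI; apply/vspaceP=> y; apply/idP/idP; last first.
  rewrite memv_cap => /andP[/memv_imgP[x xU ->] /memv_imgP[x' x'V /fI e]].
  by rewrite memv_img // memv_cap xU e.
by case/memv_imgP=> x; rewrite memv_cap => /andP[xU xV] ->; rewrite memv_cap !memv_img.
Qed.

Lemma max_meet_act k k' (P : 'M[L]_(k, k')) (Q : 'M[L]_(k', k)) W r :
    P *m Q = 1%:M -> Q *m P = 1%:M ->
  max_meet (linfun (row_act P) @: W) r = max_meet W r.
Proof.
move=> PQ QP.
have inj : injective (linfun (row_act P)).
  by move=> v w; rewrite !lfunE => /(can_inj (row_actK PQ)).
have injL (A B : nat) (M : 'M[L]_(A, B)) (N : 'M[L]_(B, A)) :
    M *m N = 1%:M -> injective (linfun (mulmxr M) : 'Hom('rV[L]_A, 'rV[L]_B)).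
  by move=> e v w; rewrite !lfunE /= => /(congr1 (mulmxr N)) /=; rewrite -!mulmxA e !mulmx1.
rewrite /max_meet dim_img_inj //; apply: eq_bigl => d; apply: asbool_equiv_eq.
have res (H : {vspace 'rV[L]_k}) :
  restrict (linfun (mulmxr P) @: H) = (linfun (row_act P) @: restrict H)%VS.
  apply/vspaceP=> y; rewrite mem_restrict; apply/memv_imgP/memv_imgP.
    move=> [v vH]; rewrite lfunE /= => e; exists (of_row v); first by rewrite mem_restrict of_rowK.
    by rewrite lfunE /= /row_act of_rowK -e to_rowK.
  move=> [v]; rewrite mem_restrict => vH ->; exists (to_row v) => //.
  by rewrite !lfunE /= /row_act of_rowK.
split=> [[H dH dW]|[H dH dW]].
  exists (linfun (mulmxr Q) @: H)%VS; first by rewrite dim_img_inj //; apply: injL QP.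
  rewrite -dW -(dim_img_inj _ inj) img_cap_inj // -res -limg_comp.
  congr (\dim (_ :&: restrict _)); apply/vspaceP=> y.
  apply/memv_imgP/idP => [[v vH ->]|yH].
    by rewrite comp_lfunE !lfunE /= -mulmxA QP mulmx1.
  by exists y => //; rewrite comp_lfunE !lfunE /= -mulmxA QP mulmx1.
exists (linfun (mulmxr P) @: H)%VS; first by rewrite dim_img_inj //; apply: injL PQ.
by rewrite res -img_cap_inj // dim_img_inj.
Qed.

Lemma row_space_sub k t (G : 'M[L]_(k, t)) (v : 'rV[L]_t) :
  v \in row_space G -> exists c : 'rV[L]_k, v = c *m G.
Proof.
have : (row_space G <= limg (linfun (mulmxr G) : 'Hom('rV[L]_k, _)))%VS.
  apply/span_subvP => _ /mapP[i _ ->]; rewrite rowE.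
  by apply/memv_imgP; exists (delta_mx 0 i); rewrite ?memvf ?lfunE.
by move=> /subvP sub /sub /memv_imgP[c _ ->]; exists c; rewrite lfunE.
Qed.

Lemma gen_rank_weightE k (W : {vspace {ffun 'I_k -> L}})
    (C : {vspace 'rV[L]_(\dim W)}) rho :
    ext_span W = fullv -> associated_code W C ->
  gen_rank_weight C rho = system_weight W rho.
Proof.
move=> spW [w wW defC].
set G := \matrix_(i, j) _ in defC.
pose B := \matrix_(i < \dim C, j < \dim W) tnth (vbasis C) i 0%R j.
have rowB i : row i B = tnth (vbasis C) i by apply/rowP=> j; rewrite !mxE.
have defG (w' : {ffun 'I_k -> L}) : w' \in W ->
    exists a : 'I_(\dim W) -> F, to_row w' = (\sum_j (a j)%:A *: (col j G)^T).
  move=> /(coord_basis wW) e; exists (fun j => coord w j w').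
  apply/rowP=> i; rewrite mxE {1}e summxE sum_ffunE; apply: eq_bigr => j _.
  by rewrite !mxE !ffunE -tnth_nth mulr_algl.
have freeG : row_free G.
  apply/inj_row_free => c cG; apply: trmx_inj; rewrite trmx0.
  have sp : (ext_span W <= lker (linfun (mulmxr c^T) : 'Hom(_, 'rV_1)))%VS.
    apply/span_subvP => _ /mapP[w' w'W ->]; rewrite memv_ker lfunE /=.
    have [a ->] := defG _ (vbasis_mem w'W).
    rewrite mulmx_suml big1 // => j _.
    by rewrite -scalemxAl -trmx_mul colE mulmxA cG mul0mx trmx0 scaler0.
  apply/row_matrixP=> i; rewrite rowE row0; apply/eqP.
  have /subvP/(_ (delta_mx 0 i)) := sp.
  by rewrite spW memvf memv_ker lfunE => /(_ isT).
have freeB : row_free B.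
  apply/inj_row_free => c; rewrite mulmx_sum_row => cB.
  have /freeP/(_ (fun i => c 0%R i)) := basis_free (vbasisP C).
  move=> c0; apply/rowP=> i; rewrite mxE; apply: c0 => {i}.
  by rewrite -[RHS]cB; apply: eq_bigr => i _; rewrite rowB -tnth_nth.
have BC : row_space B = C.
  rewrite -[RHS](span_basis (vbasisP C)); congr <<_>>%VS.
  rewrite -[RHS]map_tnth_enum; apply: eq_map => i; exact: rowB.
have chg k1 k2 (M : 'M[L]_(k1, \dim W)) (N : 'M[L]_(k2, \dim W)) :
    row_space M = row_space N -> exists P : 'M_(k1, k2), M = P *m N.
  move=> e; have h i : exists c : 'rV_k2, row i M = c *m N.
    apply: row_space_sub; rewrite -e; apply: memv_span; apply: map_f.
    exact: mem_enum.
  have [c hc] := choice h; exists (\matrix_i c i).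
  by apply/row_matrixP=> i; rewrite row_mul rowK.
have [P defB] : exists P, B = P *m G by apply: chg; rewrite BC.
have [Q defG'] : exists Q, G = Q *m B by apply: chg; rewrite BC.
have PQ : P *m Q = 1%:M.
  by apply: (row_free_inj freeB); rewrite -mulmxA -defG' -defB mul1mx.
have QP : Q *m P = 1%:M.
  by apply: (row_free_inj freeG); rewrite -mulmxA -defB -defG' mul1mx.
have dimC : \dim C = k by apply/eqP; rewrite eqn_leq !(mulmx1_min PQ, mulmx1_min QP).
have sysE : code_system C = (linfun (row_act P^T) @: W)%VS.
  have -> : (linfun (row_act P^T) @: W = linfun (row_act P^T) @: <<w>>)%VS.
    by rewrite (span_basis wW).
  rewrite limg_span; congr <<_>>%VS.
  rewrite -[in RHS](map_tnth_enum w) -[RHS]map_comp; apply: eq_map => j /=.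
  rewrite lfunE; apply/ffunP=> i; rewrite !ffunE.
  have := congr1 (fun M : 'M_(_, _) => M i j) defB; rewrite !mxE => ->.
  by apply: eq_bigr => l _; rewrite !mxE mulrC.
have QPt : Q^T *m P^T = 1%:M by rewrite -trmx_mul PQ trmx1.
have PQt : P^T *m Q^T = 1%:M by rewrite -trmx_mul QP trmx1.
rewrite /gen_rank_weight /system_weight sysE (max_meet_act _ _ PQt QPt).
rewrite dim_img_inj ?dimC // => x y; rewrite !lfunE.
exact: (can_inj (row_actK PQt)).
Qed.

End ChangeOfGenerator.

Section DirectSum.
Variables (F : finFieldType) (L : fieldExtType F) (m l : nat).

(* 'I_(m * l) is read as m consecutive blocks of l coordinates. *)
Definition in_block (j : 'I_m) (u : {ffun 'I_l -> L}) : {ffun 'I_(m * l) -> L} :=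
  of_row (mxvec (\matrix_(i < m, c < l) if i == j then u c else 0)).

Fact in_block_linear j : linear (in_block j).
Proof.
move=> a u v; rewrite /in_block -of_row_linear -linearP; congr (of_row (mxvec _)).
apply/matrixP=> i c; rewrite !mxE !ffunE.
by case: ifP; rewrite mulr_algl // scaler0 addr0.
Qed.

HB.instance Definition _ j :=
  GRing.isLinear.Build F {ffun 'I_l -> L} {ffun 'I_(m * l) -> L} *:%R
    (in_block j) (in_block_linear j).

Definition block_sum (U : 'I_m -> {vspace {ffun 'I_l -> L}}) :
    {vspace {ffun 'I_(m * l) -> L}} :=
  (\sum_(j < m) linfun (in_block j) @: U j)%VS.

End DirectSum.

Section TheFamily.
Variables (F : finFieldType) (L : fieldExtType F) (m : nat).
Implicit Types (A : {ffun 'I_m -> L}) (x : {ffun 'I_m -> L}).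

Local Notation q := #|F|.

(* Indices are shifted by one: A i is alpha_(i+1), x i is x_(i+1), and the
   cyclic successor and predecessor of i : 'I_m are ordS i and ord_pred i. *)

Definition f_coord A (h : nat) x (i : 'I_m) : L :=
  x i ^+ (q ^ h) + A (ordS i) * x (ordS i) ^+ (q ^ h.+1).

Definition V_vec A (h : nat) x : {ffun 'I_(h.+1 * m) -> L} :=
  of_row (mxvec (\matrix_(r < h.+1, i < m)
    if (r < h)%N then x i ^+ (q ^ r) else f_coord A h x i)).

Fact expr_card_linear j (a : F) (y z : L) :
  (a *: y + z) ^+ (q ^ j) = a *: y ^+ (q ^ j) + z ^+ (q ^ j).
Proof.
have [p p_pr pF] := finPcharP F.
have pL : p \in [pchar L] by rewrite pchar_lalg.
have qn : [pchar L].-nat (q ^ j)%N.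
  by rewrite (eq_pnat _ (pcharf_eq pL)) pnatX -cardsT [_.-nat _](pprimeChar_pgroup pF).
rewrite exprDn_pchar // exprZn; congr (_ *: _ + _).
by elim: j {qn} => [|j IH]; rewrite ?expr1 // expnSr exprM IH expf_card.
Qed.

Fact V_vec_linear A h : linear (V_vec A h).
Proof.
move=> a x y; rewrite /V_vec -of_row_linear -linearP; congr (of_row (mxvec _)).
apply/matrixP=> r i; rewrite !mxE /f_coord !ffunE.
case: ifP => _; rewrite !expr_card_linear mulr_algl //.
by rewrite mulrDr scalerDr addrACA scalerAr.
Qed.

HB.instance Definition _ A h :=
  GRing.isLinear.Build F {ffun 'I_m -> L} {ffun 'I_(h.+1 * m) -> L} *:%R
    (V_vec A h) (V_vec_linear A h).

Definition V_space A (h : nat) : {vspace {ffun 'I_(h.+1 * m) -> L}} :=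
  limg (linfun (V_vec A h)).

Lemma mem_V_space A h w :
  reflect (exists x, w = V_vec A h x) (w \in V_space A h).
Proof.
apply: (iffP memv_imgP) => [[x _ ->]|[x ->]]; exists x; rewrite ?memvf ?lfunE //.
Qed.

Definition is_power (N : nat) (y : L) : Prop := exists z : L, y = z ^+ N.

(* alpha_1 = A 0 gets the exponent q ^ (m - 1), and alpha_i = A (i - 1) the
   exponent q ^ (i - 2) for i >= 2. *)
Definition K_prod A : L := \prod_(i < m) A i ^+ (q ^ ord_pred i).

Definition in_calA A : Prop :=
  (forall i, A i != 0) /\ ~ is_power (\sum_(i < m) q ^ i) (K_prod A).

(* Pi_prod A i is Pi_(i+1) = alpha_(i+2) * alpha_(i+3)^q * ... *)
Definition Pi_prod A (i : 'I_m) : L :=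
  \prod_(j < m) A (iter j.+1 (@ordS m) i) ^+ (q ^ j).

Definition in_calB A : Prop :=
  in_calA A /\
  forall i2 : 'I_m, i2 = 1%N :> nat ->
  forall delta : nat, (1 <= delta <= m - 1)%N ->
    ~ is_power (q ^ m - 1) (Pi_prod A (iter delta (@ordS m) i2) / Pi_prod A i2).

End TheFamily.

(* Main.v *)
Require Import Defs.
From HB Require Import structures.
From mathcomp Require Import all_boot all_order all_algebra all_fingroup all_field.
From mathcomp Require Import boolp zify.

Set Implicit Arguments.
Unset Strict Implicit.
Unset Printing Implicit Defensive.

Import GRing.Theory.

(* The direct sum meets a sum of r = m - s blocks, of dimension r(h+1), in an
   F-space of codimension at most sn, so its weight at s(h+1) is at most sn;
   one has to show that no H of dimension r(h+1) meets V in dimension >= rn.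
   Let the columns of X : 'M_(m, w) be a basis of the x with V_vec x in H, and
   let D k be the L-rank of the matrix formed by the rows of X, X^q, ...,
   X^(q^(k-1)).  Since the (k+2)-nd row space is the sum of the (k+1)-st and of
   its Frobenius image, which intersect in at least the image of the k-th, D is
   concave; moreover D n = w >= rn, while D h + (D (h+2) - D (h+1)) <= dim H
   because the f-coordinates recover X^(q^(h+1)) from X^(q^h).
   These bounds force D k = rk for all k <= n.  Then the column space of
   X^(q^h) is an r-dimensional L-space stable under the semilinear map
   y_i |-> alpha_(i+1) y_(i+1)^q.  For r = 1 an eigenvector, and for r = m - 1
   an eigenvector of the dual map, exhibits K_A as a power; for the other r, a
   vector of minimal support is an eigenvector of the m-th iterate, which is
   diagonal with entries Pi_i, and this exhibits a ratio of them as a power. *)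

(** * Integer sequences with nonincreasing increments *)

Section ConcaveSequence.
Variable D : nat -> nat.
Hypothesis Dc : forall k, D k.+2 + D k <= (D k.+1).*2.

Lemma concave_slope i j : i <= j -> D j.+1 + D i <= D i.+1 + D j.
Proof.
move=> /subnK <-; elim: (j - i) => [|k IH]; first by rewrite add0n addnC.
by have := Dc (k + i); rewrite !addSn; lia.
Qed.

(** Subtraction-free tangent bounds: increments after i are at most the one at i, and in
    [concave_lower] those before i + k are at least the one at i + k. *)
Lemma concave_upper i k : D (i + k) + k * D i <= D i + k * D i.+1.
Proof.
elim: k => [|k IH]; first by rewrite addn0.
by have := @concave_slope i (i + k) (leq_addr _ _); rewrite addnS !mulSn; lia.
Qed.

Lemma concave_lower i k : k * D (i + k).+1 + D i <= D (i + k) + k * D (i + k).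
Proof.
elim: k => [|k IH]; first by rewrite addn0 leq_addr.
have c := Dc (i + k); have := leq_mul (leqnn k) c; rewrite addnS !mulSn; lia.
Qed.

Hypothesis D0 : D 0 = 0.

Lemma concave_chord r n : r * n <= D n -> forall k, k <= n -> r * k <= D k.
Proof.
move=> rn k kn; rewrite leqNgt; apply/negP=> Dk.
have := concave_lower 0 k; rewrite add0n D0 addn0 => low.
have := concave_upper k (n - k); rewrite subnKC // => up.
(* If D k < rk, [low] makes the increment at k less than r, and [up] then gives D n < rn. *)
have sl : D k.+1 < D k + r by nia.
have e : r * n = r * k + (n - k) * r by rewrite mulnC [(n-k)*r]mulnC -mulnDr subnKC // mulnC.
nia.
Qed.

Lemma concave_linear r n : r * n <= D n -> D 1 <= r ->
  forall k, k <= n -> D k = r * k.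
Proof.
move=> rn D1 k kn; apply/eqP; rewrite eqn_leq (concave_chord rn) // andbT.
have := concave_upper 0 k; rewrite add0n D0 muln0 addn0 add0n; nia.
Qed.

(** Let r - t be the increment at h + 1 and p = n - h - 2; the hypotheses give t >= 0 and D h <= rh
    + t. If t = 0, the increments before h + 1 are at least r, so D h <= rh forces D 1 <= r. If t >
    0, the tangent at h + 1 gives D n < rn - p(t - 1), a contradiction. *)
Lemma concave_extremal r n h d :
    0 < h -> h.+1 < n -> r * n <= D n -> d <= r * h.+1 ->
    D h + D h.+2 <= D h.+1 + d -> D h.+1 < D h + r + (n - h - 2) ->
  forall k, k <= n -> D k = r * k.
Proof.
move=> h0 hn rn dr Dd Dh; apply: concave_linear => //.
have ch := concave_chord rn.
have [ch0 ch1 ch2] : [/\ r * h <= D h, r * h.+1 <= D h.+1 & r * h.+2 <= D h.+2].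
  by split; apply: ch; lia.
have [t et] : exists t, D h.+2 + t = D h.+1 + r.
  exists (D h.+1 + r - D h.+2); apply: subnKC; nia.
have Dht : D h <= r * h + t by nia.
have [t0|t0] := posnP t.
  have := concave_lower 1 h.-1; rewrite add1n prednK // => low.
  have := Dc h; nia.
have := concave_upper h.+1 (n - h.+1); rewrite subnKC; last by lia.
have [p ep] : exists p, n - h.+1 = p.+1 by exists (n - h - 2); lia.
have e : n = h + p.+2 by lia.
have e2 : n - h - 2 = p by lia.
rewrite ep e2 in Dh *; rewrite e in rn *.
nia.
Qed.

End ConcaveSequence.

Local Open Scope ring_scope.

(** * Eigenvectors of diagonal semilinear maps *)

Section MinimalSupport.
Variables (K : fieldType) (f : {rmorphism K -> K}) (m : nat) (b : 'rV[K]_m).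

Definition semidiag (y : 'rV[K]_m) : 'rV[K]_m := \row_i (b 0 i * f (y 0 i)).

(* A vector of minimal support, scaled to have a coordinate 1, is an
   eigenvector, since its image minus a multiple of it has smaller support. *)
Lemma semidiag_eigenvector N (Y : 'M[K]_(N, m)) :
    Y != 0 -> (forall y : 'rV_m, (y <= Y)%MS -> (semidiag y <= Y)%MS) ->
  exists (y : 'rV[K]_m) i0,
    [/\ (y <= Y)%MS, y 0 i0 = 1 & forall i, b 0 i * f (y 0 i) = b 0 i0 * y 0 i].
Proof.
move=> Y0 stY.
pose supp (y : 'rV[K]_m) := [set i | y 0 i != 0].
suff ind k (y : 'rV[K]_m) : (#|supp y| <= k)%N -> (y <= Y)%MS -> y != 0 ->
    exists (z : 'rV[K]_m) i0,
    [/\ (z <= Y)%MS, z 0 i0 = 1 & forall i, b 0 i * f (z 0 i) = b 0 i0 * z 0 i].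
  by have [i /(ind _ _ (leqnn _))] := rowV0Pn Y0; apply.
elim: k y => [|k IH] y.
  rewrite leqn0 cards_eq0 => /eqP s0 _ /eqP[]; apply/rowP=> i; rewrite mxE.
  by apply/eqP; move/setP/(_ i): s0; rewrite !inE => /negbFE.
move=> sk yY /rV0Pn[i0 yi0].
pose z := (y 0 i0)^-1 *: y.
have zY : (z <= Y)%MS by rewrite scalemx_sub.
have zi0 : z 0 i0 = 1 by rewrite mxE mulVf.
pose t := semidiag z - b 0 i0 *: z.
have tY : (t <= Y)%MS by rewrite addmx_sub ?stY // -scaleNr scalemx_sub.
have [t0|t0] := eqVneq t 0.
  exists z, i0; split=> // i; apply/eqP; rewrite -subr_eq0; apply/eqP.
  by have := congr1 (fun v : 'rV_m => v 0 i) t0; rewrite !mxE.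
apply: IH tY t0; rewrite -ltnS; apply: leq_trans sk; apply: proper_card.
apply/properP; split; last first.
  by exists i0; rewrite !inE // !mxE mulVf // rmorph1 subrr eqxx.
apply/subsetP=> i; rewrite !inE; apply: contraNneq => yi.
by rewrite !mxE yi mulr0 rmorph0 !mulr0 subrr.
Qed.

End MinimalSupport.

(** * Ranks generated by the Frobenius powers of a matrix *)

Section Frobenius.
Variables (F : finFieldType) (L : fieldExtType F).

Local Notation q := #|F|.

Definition frob (j : nat) (y : L) : L := y ^+ (q ^ j).

Fact frob_is_zmod_morphism j : zmod_morphism (frob j).
Proof.
move=> x y; have := expr_card_linear j (-1 : F) y x.
by rewrite /frob !scaleN1r addrC => ->; rewrite addrC.
Qed.

Fact frob_is_monoid_morphism j : monoid_morphism (frob j).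
Proof. by split=> [|x y]; rewrite /frob ?expr1n ?exprMn. Qed.

HB.instance Definition _ j :=
  GRing.isZmodMorphism.Build L L (frob j) (frob_is_zmod_morphism j).
HB.instance Definition _ j :=
  GRing.isMonoidMorphism.Build L L (frob j) (frob_is_monoid_morphism j).

Lemma frob0 y : frob 0 y = y. Proof. exact: expr1. Qed.

Lemma frobD i j y : frob i (frob j y) = frob (i + j) y.
Proof. by rewrite /frob -exprM -expnD addnC. Qed.

Lemma frob_dim y : frob (\dim {:L}) y = y.
Proof. by apply/eqP; rewrite -Fermat's_little_theorem memvf. Qed.

Lemma frob_fixed y : (frob 1 y == y) = (y \in 1%VS).
Proof. by rewrite (Fermat's_little_theorem 1%AS) /= dimv1. Qed.

Section Tower.
Variables (m w : nat) (X : 'M[L]_(m, w)).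

Definition tower k : 'M[L]_w := (\sum_(j < k) <<map_mx (frob j) X>>)%MS.

Lemma tower_recr k :
  tower k.+1 = (tower k + <<map_mx (frob k) X>>)%MS.
Proof. by rewrite /tower big_ord_recr. Qed.

Lemma tower_subP k N (B : 'M[L]_(N, w)) :
  reflect (forall j, (j < k)%N -> (map_mx (frob j) X <= B)%MS)
          (tower k <= B)%MS.
Proof.
apply: (iffP sumsmx_subP) => [sB j jk|sB j _]; last by rewrite genmxE sB.
by have := sB (Ordinal jk) isT; rewrite genmxE.
Qed.

Lemma sub_tower k j : (j < k)%N -> (map_mx (frob j) X <= tower k)%MS.
Proof. by move: j; apply/tower_subP. Qed.

Lemma map_frobD i j : map_mx (frob i) (map_mx (frob j) X) = map_mx (frob (i + j)) X.
Proof. by rewrite -map_mx_comp; apply: eq_map_mx => y; apply: frobD. Qed.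

Lemma frob_tower_sub k : (map_mx (frob 1) (tower k) <= tower k.+1)%MS.
Proof.
elim: k => [|k IH]; first by rewrite /tower !big_ord0 map_mx0 sub0mx.
rewrite [in X in (X <= _)%MS]tower_recr map_addsmx addsmx_sub.
rewrite (submx_trans IH) /=; last by rewrite [X in (_ <= X)%MS]tower_recr addsmxSl.
by rewrite map_genmx genmxE map_frobD sub_tower.
Qed.

Lemma tower_concave k :
  (\rank (tower k.+2) + \rank (tower k) <= (\rank (tower k.+1)).*2)%N.
Proof.
set S := tower k.+1; set T := map_mx (frob 1) S.
have rT : \rank T = \rank S by apply: mxrank_map.
rewrite -addnn -[X in (_ <= _ + X)%N]rT -[leqRHS]mxrank_sum_cap leq_add //.
  apply/mxrankS; apply/tower_subP => -[|j] jk.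
    by apply: submx_trans (addsmxSl _ _); apply: sub_tower.
  apply: submx_trans (addsmxSr _ _); rewrite -[j.+1]add1n -map_frobD map_submx.
  exact: sub_tower.
rewrite -(mxrank_map (frob 1)) mxrankS // sub_capmx frob_tower_sub.
by rewrite map_submx [S]tower_recr addsmxSl.
Qed.

(** The right kernel of the stacked blocks X, X^q, ..., X^(q^(n-1)) is stable under Frobenius, which
    permutes the blocks cyclically. If it were nonzero, it would contain a nonzero Frobenius-fixed
    vector, that is, an F-linear relation between the columns of X. *)
Lemma rank_tower_dim :
    (forall c : 'I_w -> F,
       (forall i, \sum_l (c l)%:A * X i l = 0) -> forall l, c l = 0) ->
  \rank (tower (\dim {:L})) = w.
Proof.
move=> freeX; set n := \dim {:L}.
have memY (y : 'rV_w) : reflect (forall j, (j < n)%N -> map_mx (frob j) X *m y^T = 0)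
    (y <= kermx (tower n)^T)%MS.
  have -> : (y <= kermx (tower n)^T)%MS = (tower n <= kermx y^T)%MS.
    rewrite !(sameP sub_kermxP eqP) -(inj_eq (@trmx_inj _ _ _)) trmx_mul.
    by rewrite trmxK trmx0.
  apply: (iffP (tower_subP _ _)) => yX j jn; first exact/sub_kermxP/yX.
  by apply/sub_kermxP; apply: yX.
have [k0|k0] := eqVneq (kermx (tower n)^T) 0.
  have := mxrank_ker (tower n)^T; rewrite k0 mxrank0 mxrank_tr => /esym/eqP.
  by rewrite subn_eq0 => wr; apply/eqP; rewrite eqn_leq rank_leq_col.
have n0 : (0 < n)%N.
  rewrite lt0n dimv_eq0 -subv0.
  by apply/negP=> /subvP/(_ 1 (memvf _)); rewrite memv0 oner_eq0.
have [|y [i0 [/memY yX yi0 fixy]]] := @semidiag_eigenvector _ (frob 1) _ (const_mx 1) _ _ k0.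
  move=> y /memY yX; apply/memY => j jn.
  have -> : semidiag (frob 1) (const_mx 1) y = map_mx (frob 1) y.
    by apply/rowP=> i; rewrite !mxE mul1r.
  (* Block 0 is the Frobenius image of block n - 1, since [frob n] is the identity on L. *)
  case: j jn => [|j] jn.
    have -> : map_mx (frob 0) X = map_mx (frob 1) (map_mx (frob n.-1) X).
      rewrite map_frobD add1n prednK //; apply/matrixP=> i l.
      by rewrite !mxE frob0 frob_dim.
    by rewrite map_trmx -map_mxM yX ?prednK // map_mx0.
  by rewrite -(map_frobD 1 j) map_trmx -map_mxM yX 1?ltnW // map_mx0.
have inF l : exists c : F, y 0 l = c%:A.
  by apply/vlineP; rewrite -frob_fixed; have := fixy l; rewrite !mxE !mul1r => ->.
have [c yc] := fin_all_exists inF.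
have /(_ i0) c0 : forall l, c l = 0.
  apply: freeX => i; have := congr1 (fun M : 'cV_m => M i 0) (yX 0%N n0).
  rewrite !mxE => e; rewrite -[RHS]e; apply: eq_bigr => l _.
  by rewrite !mxE frob0 yc mulrC.
by move: yi0; rewrite yc c0 scale0r => /esym/eqP; rewrite oner_eq0.
Qed.

End Tower.
End Frobenius.

(** * The twisted cyclic shift and its stable subspaces *)

Lemma rank1_scalar (K : fieldType) (m : nat) N
    (B : 'M[K]_(N, m)) (x y : 'rV[K]_m) :
  \rank B = 1%N -> x != 0 -> (x <= B)%MS -> (y <= B)%MS -> exists l, y = l *: x.
Proof.
move=> B1 x0 xB yB; apply/sub_rVP; apply: submx_trans yB _.
by rewrite -(geq_leqif (mxrank_leqif_sup xB)) B1 lt0n mxrank_eq0.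
Qed.

Section CyclicShift.
Variables (F : finFieldType) (L : fieldExtType F) (m : nat).
Implicit Types (A : {ffun 'I_m -> L}) (x y : 'rV[L]_m).

Local Notation q := #|F|.

(** With y = x^(q^h), the f-coordinates of x form the vector y + [twist A y]. *)
Definition twist A y : 'rV[L]_m := \row_i (A (ordS i) * frob 1 (y 0 (ordS i))).

Definition twist_stable A N (Y : 'M[L]_(N, m)) : Prop :=
  forall y : 'rV_m, (y <= Y)%MS -> (twist A y <= Y)%MS.

Lemma val_iter_ordS k (i : 'I_m) : iter k (@ordS m) i = ((i + k) %% m)%N :> nat.
Proof.
elim: k => [|k IH]; first by rewrite addn0 modn_small.
by rewrite iterS /= IH -addn1 modnDml addn1 addnS.
Qed.

Lemma iter_ordS_trans (i j : 'I_m) : exists2 k, (k < m)%N & j = iter k (@ordS m) i.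
Proof.
have m0 : (0 < m)%N by apply: leq_trans (ltn_ord i).
exists ((j + (m - i)) %% m)%N; first exact: ltn_pmod.
apply/val_inj; rewrite /= val_iter_ordS modnDmr addnCA subnKC 1?ltnW //.
by rewrite modnDr modn_small.
Qed.

Lemma iter_ordS_id (i : 'I_m) : iter m (@ordS m) i = i.
Proof. by apply/val_inj; rewrite /= val_iter_ordS modnDr modn_small. Qed.

Lemma iter_can (T : Type) (f g : T -> T) k :
  cancel f g -> cancel (iter k f) (iter k g).
Proof. by move=> fK; elim: k => [|k IH] i //; rewrite iterSr /= fK IH. Qed.

Lemma cyclic_nonzero y :
    y != 0 -> (forall i, (y 0 (ordS i) == 0) = (y 0 i == 0)) ->
  forall i, y 0 i != 0.
Proof.
move=> /rV0Pn[i0 yi0] ys i; have [k _ ->] := iter_ordS_trans i0 i.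
by elim: k => //= k IH; rewrite ys.
Qed.

(** Raise the i-th relation to the power q^(i-1), with i - 1 read cyclically, and multiply. Both
    sides contain the product of the x_i^(q^i), except that x_0 has exponent q^m on the right; the
    excess x_0^(q^m - 1) is the (1 + q + ... + q^(m-1))-th power of x_0^(q-1). *)
Lemma K_prod_is_power A x l : (forall i, x 0 i != 0) ->
    (forall i, A i * x 0 (ord_pred i) = l * frob 1 (x 0 i)) ->
  is_power (\sum_(i < m) q ^ i)%N (K_prod A).
Proof.
case: m A x => [|m'] A x x0 Ax.
  by exists 1; rewrite /K_prod !big_ord0 expr0.
exists (l * x 0 0 ^+ (q - 1)).
pose P := \prod_(i < m'.+1) x 0 i ^+ (q ^ i).
have P0 : P != 0 by apply/prodf_neq0 => i _; rewrite expf_neq0.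
apply: (mulIf P0); transitivity (\prod_i (A i * x 0 (ord_pred i)) ^+ (q ^ ord_pred i)).
  rewrite /P (reindex_onto (@ord_pred _) (@ordS _)) /=; last by move=> i _; rewrite ordSK.
  rewrite [in LHS](eq_bigl xpredT) => [|i]; last by rewrite ord_predK eqxx.
  by rewrite /K_prod -big_split /=; apply: eq_bigr => i _; rewrite exprMn.
under eq_bigr do rewrite Ax exprMn.
rewrite big_split /= prodrXr !exprMn -exprM.
have -> : (\sum_(i < m'.+1) q ^ ord_pred i = \sum_(i < m'.+1) q ^ i)%N.
  rewrite [RHS](reindex_inj (@ord_pred_inj _)) /=.
  by apply: eq_bigr.
rewrite -mulrA; congr (_ * _).
rewrite subn1 -predn_exp /P !big_ord_recl mulrA; congr (_ * _).
  rewrite /frob expn0 expr1 expn1 -exprM -expnS -exprSr prednK ?expn_gt0 -?cardsT ?cardG_gt0 //.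
  by congr (_ ^+ (_ ^ _)); exact: (congr1 S (@modn_small m' m'.+1 _)).
apply: eq_bigr => i _; rewrite /frob -exprM expn1 -expnS; congr (_ ^+ (q ^ _)).
by rewrite [in LHS]/= lift0 add0n modnDr modn_small // ltnS ltnW.
Qed.

Section Stable.
Variables (A : {ffun 'I_m -> L}) (N : nat) (Y : 'M[L]_(N, m)).
Hypotheses (A0 : forall i, A i != 0) (stY : twist_stable A Y).

Lemma stable_line_K_prod :
  \rank Y = 1%N -> is_power (\sum_(i < m) q ^ i)%N (K_prod A).
Proof.
move=> Y1; have /rowV0Pn[y yY y0] : Y != 0 by rewrite -mxrank_eq0 Y1.
have [l yl] := rank1_scalar Y1 y0 yY (stY yY).
have Ay i : A (ordS i) * frob 1 (y 0 (ordS i)) = l * y 0 i.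
  by have := congr1 (fun v : 'rV_m => v 0 i) yl; rewrite !mxE.
have l0 : l != 0.
  apply: contraNneq y0 => l0; apply/eqP/rowP=> i; rewrite mxE -(ord_predK i).
  apply/eqP; have /eqP := Ay (ord_pred i).
  by rewrite l0 mul0r mulf_eq0 (negbTE (A0 _)) fmorph_eq0.
have yn0 := cyclic_nonzero y0 _.
have {}yn0 : forall i, y 0 i != 0.
  apply: yn0 => i; have /(congr1 (eq_op^~ 0)) := Ay i.
  by rewrite !mulf_eq0 (negbTE l0) (negbTE (A0 _)) fmorph_eq0.
(* The relation A_i y_i^q = l y_(i-1) reads A_i / y_(i-1) = l / y_i^q. *)
apply: (@K_prod_is_power _ (\row_i (y 0 i)^-1) l) => i; rewrite !mxE ?invr_eq0 //.
rewrite fmorphV; apply: (mulIf (yn0 (ord_pred i))).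
rewrite mulfVK // -{1}[i]ord_predK; apply: (mulIf (_ : frob 1 (y 0 i) != 0)).
  by rewrite fmorph_eq0.
by rewrite -{2}[i]ord_predK Ay mulrAC mulfVK ?fmorph_eq0 // mulrC.
Qed.

(** Let x span the line orthogonal to Y. The adjoint of the twist sends x to [x'], which is
    orthogonal to the Frobenius image of Y and hence a multiple of x^q. *)
Lemma stable_hyperplane_K_prod :
  (0 < m)%N -> \rank Y = m.-1 -> is_power (\sum_(i < m) q ^ i)%N (K_prod A).
Proof.
move=> m0 Ym.
have rk (Z : 'M[L]_(N, m)) : \rank Z = m.-1 -> \rank (kermx Z^T) = 1%N.
  by rewrite mxrank_ker mxrank_tr => ->; case: (m) m0 => // k _; rewrite subSnn.
have /rowV0Pn[x /sub_kermxP xY x0] : kermx Y^T != 0 by rewrite -mxrank_eq0 rk.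
pose x' : 'rV_m := \row_j (A j * x 0 (ord_pred j)).
have [l xl] : exists l, x' = l *: map_mx (frob 1) x.
  apply: (@rank1_scalar _ _ _ (kermx (map_mx (frob 1) Y)^T)).
  - by rewrite rk // mxrank_map.
  - by rewrite map_mx_eq0.
  - by apply/sub_kermxP; rewrite map_trmx -map_mxM xY map_mx0.
  apply/sub_kermxP/rowP=> r; rewrite !mxE (reindex_inj (@ordS_inj _)) /=.
  have /submxP[c ec] := stY (row_sub r Y).
  have := congr1 (fun M : 'M_1 => M 0 0) (congr1 (mulmx c) (congr1 trmx xY)).
  rewrite trmx_mul trmxK mulmxA -ec trmx0 mulmx0 !mxE => e; rewrite -[RHS]e.
  by apply: eq_bigr => i _; rewrite !mxE ordSK mulrAC.
have Ax i : A i * x 0 (ord_pred i) = l * frob 1 (x 0 i).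
  by have := congr1 (fun v : 'rV_m => v 0 i) xl; rewrite !mxE.
have l0 : l != 0.
  apply: contraNneq x0 => l0; apply/eqP/rowP=> i; rewrite mxE -(ordSK i).
  apply/eqP; have /eqP := Ax (ordS i).
  by rewrite l0 mul0r mulf_eq0 (negbTE (A0 _)).
apply: (K_prod_is_power _ Ax); apply: cyclic_nonzero => // i.
have /(congr1 (eq_op^~ 0)) := Ax (ordS i).
by rewrite !mulf_eq0 (negbTE l0) (negbTE (A0 _)) fmorph_eq0 ordSK.
Qed.

Lemma iter_twistE k y i :
  iter k (twist A) y 0 i =
  (\prod_(j < k) A (iter j.+1 (@ordS m) i) ^+ (q ^ j)) * frob k (y 0 (iter k (@ordS m) i)).
Proof.
elim: k i => [|k IH] i; first by rewrite big_ord0 mul1r frob0.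
rewrite iterS mxE IH rmorphM /= frobD add1n mulrA -iterSr; congr (_ * _).
rewrite big_ord_recl /= rmorph_prod expr1; congr (_ * _).
apply: eq_bigr => j _ /=; rewrite /frob -exprM -expnD addn1. by rewrite -iterSr.
Qed.

Lemma twist_cycle y : iter m (twist A) y = semidiag (frob m) (\row_i Pi_prod A i) y.
Proof. by apply/rowP=> i; rewrite iter_twistE iter_ordS_id !mxE. Qed.

(** Both sides are one product of m + 1 cyclically consecutive factors, with the last or the first
    detached. *)
Lemma Pi_prod_ordS i :
  Pi_prod A i * A (ordS i) ^+ (q ^ m) = A (ordS i) * Pi_prod A (ordS i) ^+ q.
Proof.
transitivity (\prod_(j < m.+1) A (iter j.+1 (@ordS m) i) ^+ (q ^ j)).
  by rewrite big_ord_recr /= iter_ordS_id.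
rewrite big_ord_recl expr1 -prodrXl; congr (_ * _); apply: eq_bigr => j _.
by rewrite -exprM -expnSr /= add0n -!iterS iterSr.
Qed.

Lemma Pi_prod_neq0 i : Pi_prod A i != 0.
Proof. by apply/prodf_neq0 => j _; rewrite expf_neq0. Qed.

(** By [Pi_prod_ordS], Pi_(t-1) is Pi_t^q / A_t^(q^m - 1). Rotating both indices will bring the
    denominator to any chosen index. *)
Lemma Pi_ratio_pred i j :
  is_power (q ^ m - 1) (Pi_prod A i / Pi_prod A j) ->
  is_power (q ^ m - 1) (Pi_prod A (ord_pred i) / Pi_prod A (ord_pred j)).
Proof.
move=> [z ez].
have shift t : Pi_prod A (ord_pred t) = Pi_prod A t ^+ q / A t ^+ (q ^ m - 1).
  have := Pi_prod_ordS (ord_pred t); rewrite ord_predK => e.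
  have qm : (q ^ m = (q ^ m - 1).+1)%N by rewrite subn1 prednK // expn_gt0 -cardsT cardG_gt0.
  apply: (mulIf (expf_neq0 (q ^ m - 1) (A0 t))); apply: (mulIf (A0 t)).
  by rewrite mulfVK ?expf_neq0 // -mulrA -exprSr -qm e mulrC.
exists (z ^+ q * (A j / A i)); rewrite !shift exprMn exprAC -ez !expr_div_n.
by rewrite invf_div !mulf_div [X in _ / X]mulrC.
Qed.

Lemma stable_Pi_ratio i2 :
    Y != 0 -> ~~ row_full Y ->
  exists2 d, (1 <= d <= m - 1)%N &
    is_power (q ^ m - 1) (Pi_prod A (iter d (@ordS m) i2) / Pi_prod A i2).
Proof.
move=> Y0 nfY.
have [y yY|y [i0 [yY yi0 ey]]] :=
    @semidiag_eigenvector _ (frob m) _ (\row_i Pi_prod A i) _ _ Y0.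
  have it k : (iter k (twist A) y <= Y)%MS by elim: k => //= k; apply: stY.
  by rewrite -twist_cycle.
have [i1 /andP[i10 yi1]|noi] := pickP (fun i => (i != i0) && (y 0 i != 0)); last first.
  (* If y is a unit vector, Y is everything: the twist of a unit vector is a nonzero multiple of the
     preceding one. *)
  case/negP: nfY.
  have eq_y : y = delta_mx 0 i0.
    apply/rowP=> i; rewrite mxE; have := noi i; have [->|ii] := eqVneq i i0; first by rewrite yi0.
    by rewrite andbF => /negbFE/eqP.
  have dY i : ((delta_mx 0 i : 'rV[L]_m) <= Y)%MS.
    have [k _ e] := iter_ordS_trans i i0.
    elim: k i e => [|k IH] i e; first by move: e => /= <-; rewrite -eq_y.
    have := stY (IH (ordS i) _); rewrite -iterSr => /(_ e).
    have -> : twist A (delta_mx 0 (ordS i)) = A (ordS i) *: delta_mx 0 i.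
      apply/rowP=> t; rewrite !mxE /= (inj_eq (@ordS_inj _)).
      by case: eqP => [->|]; rewrite ?rmorph1 ?rmorph0 ?mulr0.
    by rewrite (eqmx_scale _ (A0 _)).
  by rewrite -sub1mx; apply/row_subP=> i; rewrite rowE mulmx1.
have P10 : is_power (q ^ m - 1) (Pi_prod A i1 / Pi_prod A i0).
  (* The eigenvector equation gives the ratio as y_(i1)^(1 - q^m). *)
  exists (y 0 i1)^-1; have := ey i1; rewrite !mxE /frob => e.
  have qm : (q ^ m = (q ^ m - 1).+1)%N by rewrite subn1 prednK // expn_gt0 -cardsT cardG_gt0.
  apply: (mulIf (expf_neq0 (q ^ m - 1) yi1)); rewrite exprVn mulVf ?expf_neq0 //.
  apply: (mulIf yi1); apply: (mulIf (Pi_prod_neq0 i0)).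
  by rewrite mul1r -[_ * _ * y 0 i1]mulrA -exprSr -qm mulrAC mulfVK ?Pi_prod_neq0 // e mulrC.
have [k _ ek] := iter_ordS_trans i2 i0.
have {}P10 : is_power (q ^ m - 1)
    (Pi_prod A (iter k (@ord_pred m) i1) / Pi_prod A (iter k (@ord_pred m) i0)).
  by elim: {ek}k => //= k IH; apply: Pi_ratio_pred.
rewrite [in X in _ / X]ek (iter_can _ (@ordSK _)) in P10.
have [d dm ed] := iter_ordS_trans i2 (iter k (@ord_pred m) i1).
exists d; last by rewrite -ed.
(* The case d = 0 would give i1 = i0. *)
case: d => [|d] in dm ed *; last by lia.
by case/eqP: i10; rewrite ek -[i2]/(iter 0 (@ordS m) i2) -ed (iter_can _ (@ord_predK _)).
Qed.

End Stable.
End CyclicShift.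

(** * Sections of V by an L-subspace H *)

Section HyperplaneSections.
Variables (F : finFieldType) (L : fieldExtType F) (m : nat).
Variables (A : {ffun 'I_m -> L}) (h : nat).

Section Matrix.
Variables (w : nat) (X : 'M[L]_(m, w)).

Definition shift_mx : 'M[L]_(m, w) :=
  \matrix_(i, l) (A (ordS i) * frob h.+1 (X (ordS i) l)).

Definition f_mx : 'M[L]_(m, w) := map_mx (frob h) X + shift_mx.

Lemma shift_mx_sub : (shift_mx <= map_mx (frob h.+1) X)%MS.
Proof.
apply/row_subP=> i; have -> : row i shift_mx = A (ordS i) *: row (ordS i) (map_mx (frob h.+1) X).
  by apply/rowP=> l; rewrite !mxE.
by rewrite scalemx_sub ?row_sub.
Qed.

(** Dimension formula for [tower X h.+1] and [T]: they meet in at least [tower X h], and dividing by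
    A_i shows that their sum contains X^(q^(h+1)). *)
Lemma rank_tower_f_mx : (forall i, A i != 0) ->
  (\rank (tower X h) + \rank (tower X h.+2)
     <= \rank (tower X h.+1) + \rank (tower X h + f_mx)%MS)%N.
Proof.
move=> A0; set T := (_ + f_mx)%MS; rewrite -[leqRHS]mxrank_sum_cap addnC leq_add //.
  have XT : (map_mx (frob h) X <= tower X h.+1 + T)%MS.
    by apply: submx_trans (addsmxSl _ _); apply: sub_tower.
  have fT : (f_mx <= tower X h.+1 + T)%MS.
    by apply: submx_trans (addsmxSr _ _); apply: addsmxSr.
  apply: mxrankS; rewrite [X in (X <= _)%MS]tower_recr addsmx_sub addsmxSl genmxE /=.
  apply/row_subP=> i; rewrite -[i]ord_predK; set j := ord_pred i.
  have -> : row (ordS j) (map_mx (frob h.+1) X) =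
      (A (ordS j))^-1 *: (row j f_mx - row j (map_mx (frob h) X)).
    by apply/rowP=> l; rewrite !mxE addrC addKr mulKf.
  by rewrite scalemx_sub // addmx_sub ?eqmx_opp // (submx_trans (row_sub _ _)).
by apply: mxrankS; rewrite sub_capmx addsmxSl tower_recr addsmxSl.
Qed.

(** The ranks make the row spaces of [tower X h], [X0] and [X1] independent, so [f_mx] has rank at
    most r and the same left kernel as [X0]. That kernel then kills [shift_mx], whose columns, the
    twists of those of [X0], thus lie in the column space of [X0]. *)
Lemma twist_stable_frob r :
    (forall k, (k <= h.+2)%N -> \rank (tower X k) = (r * k)%N) ->
    (\rank (tower X h + f_mx)%MS <= r * h.+1)%N ->
  twist_stable A (map_mx (frob h) X)^T.
Proof.
move=> rk rkf.
set X0 := map_mx (frob h) X; set X1 := map_mx (frob h.+1) X.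
have rX j : \rank (map_mx (frob j) X) = r.
  rewrite mxrank_map -(mxrank_map (frob 0)).
  by have := rk 1%N isT; rewrite tower_recr /tower big_ord0 adds0mx genmxE muln1.
have capT : \rank (tower X h :&: (X0 + X1))%MS = 0%N /\ \rank (X0 :&: X1)%MS = 0%N.
  have e : (tower X h.+2 :=: tower X h + (X0 + X1))%MS.
    rewrite !tower_recr; apply/eqmxP/andP; split.
      by rewrite !addsmx_sub !genmxE addsmxSl /=; apply/andP; split;
        apply: submx_trans (addsmxSr _ _); rewrite ?addsmxSl ?addsmxSr.
    rewrite !addsmx_sub; apply/and3P; split.
    - by apply: submx_trans (addsmxSl _ _); apply: addsmxSl.
    - by apply: submx_trans (addsmxSl _ _); apply: submx_trans (addsmxSr _ _); rewrite genmxE.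
    - by apply: submx_trans (addsmxSr _ _); rewrite genmxE.
  have := mxrank_sum_cap (tower X h) (X0 + X1)%MS.
  have := mxrank_sum_cap X0 X1; rewrite -e !rX !rk //; lia.
case: capT => /eqP; rewrite mxrank_eq0 => /eqP capT /eqP; rewrite mxrank_eq0 => /eqP cap01.
have fX : (f_mx <= X0 + X1)%MS by rewrite addmx_sub_adds // shift_mx_sub.
have rf : (\rank f_mx <= r)%N.
  have := mxrank_sum_cap (tower X h) f_mx.
  have -> : \rank (tower X h :&: f_mx)%MS = 0%N.
    by apply/eqP; rewrite mxrank_eq0 -submx0 -capT capmxS.
  rewrite addn0 rk //; move: rkf; lia.
(* If c kills [f_mx], then c [X0] = - c [shift_mx] lies in both row spaces, so it is 0. *)
have kf : (kermx f_mx <= kermx X0)%MS.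
  apply/sub_kermxP/eqP; rewrite -submx0 -cap01 sub_capmx submxMl /=.
  have -> : kermx f_mx *m X0 = - (kermx f_mx *m shift_mx).
    by apply/eqP; rewrite -addr_eq0 -mulmxDr mulmx_ker.
  by rewrite eqmx_opp (submx_trans (submxMl _ _)) ?shift_mx_sub.
have kX : (kermx X0 <= kermx f_mx)%MS.
  by rewrite -(geq_leqif (mxrank_leqif_sup kf)) !mxrank_ker rX leq_sub2l.
have ks : kermx X0 *m shift_mx = 0.
  by move/sub_kermxP: kX; rewrite mulmxDr mulmx_ker add0r.
have sX : (shift_mx^T <= X0^T)%MS.
  rewrite submxE -(inj_eq (@trmx_inj _ _ _)) trmx_mul trmxK trmx0.
  have /submxP[c ->] : ((cokermx X0^T)^T <= kermx X0)%MS.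
    by apply/sub_kermxP; rewrite -[X in _ *m X]trmxK -trmx_mul mulmx_coker trmx0.
  by rewrite -mulmxA ks mulmx0.
move=> y /submxP[c ->].
have -> : twist A (c *m X0^T) = map_mx (frob 1) c *m shift_mx^T.
  apply/rowP=> i; rewrite !mxE rmorph_sum mulr_sumr; apply: eq_bigr => l _.
  by rewrite !mxE rmorphM /= frobD add1n mulrCA.
by rewrite (submx_trans (submxMl _ _)).
Qed.

End Matrix.

(** The columns of X are the preimages of a basis of the section. With these basis vectors as its
    columns, [M] has rank at most dim H, and its rows include those of [f_mx X] and of X^(q^j) for j
    < h. *)
Lemma section_matrix (H : {vspace 'rV[L]_(h.+1 * m)}) :
  exists X : 'M[L]_(m, \dim (V_space A h :&: restrict H)),
    (forall c : 'I__ -> F, (forall i, \sum_l (c l)%:A * X i l = 0) -> forall l, c l = 0)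
    /\ (\rank (tower X h + f_mx X)%MS <= \dim H)%N.
Proof.
set W := (_ :&: _)%VS; set w := \dim W.
have sec (l : 'I_w) : exists x, (vbasis W)`_l = V_vec A h x.
  apply/mem_V_space; have : (vbasis W)`_l \in W.
    by rewrite vbasis_mem // mem_nth // size_tuple.
  by rewrite memv_cap => /andP[].
have [x ex] := fin_all_exists sec.
pose X : 'M[L]_(m, w) := \matrix_(i, l) x l i.
exists X; split.
  move=> c cX; apply: (freeP (basis_free (vbasisP W))).
  under eq_bigr do rewrite ex -linearZ; rewrite -linear_sum.
  rewrite (_ : \sum_l c l *: x l = 0) ?linear0 //.
  apply/ffunP=> i; rewrite sum_ffunE ffunE -[RHS](cX i); apply: eq_bigr => l _.
  by rewrite !ffunE mxE mulr_algl.
pose M : 'M[L]_(h.+1 * m, w) := \matrix_(p, l) (vbasis W)`_l p.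
have rM : (\rank M <= \dim H)%N.
  pose B : 'M[L]_(\dim H, _) := \matrix_i (vbasis H)`_i.
  suff /mxrankS : (M^T <= B)%MS.
    by rewrite mxrank_tr => /leq_trans -> //; apply: rank_leq_row.
  apply/row_subP => l.
  have -> : row l M^T = to_row (vbasis W)`_l by apply/rowP=> p; rewrite !mxE.
  have : to_row (vbasis W)`_l \in H.
    rewrite -mem_restrict; have : (vbasis W)`_l \in W.
      by rewrite vbasis_mem // mem_nth // size_tuple.
    by rewrite memv_cap => /andP[].
  move=> /coord_vbasis ->; apply: summx_sub => i _; apply: scalemx_sub.
  by rewrite -(rowK (fun i : 'I_(\dim H) => (vbasis H)`_i) i) row_sub.
apply: leq_trans rM; apply: mxrankS.
have rowM (r : 'I_h.+1) i : row (mxvec_index r i) M =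
    if (r < h)%N then row i (map_mx (frob r) X) else row i (f_mx X).
  apply/rowP=> l; rewrite !mxE ex ffunE mxvecE mxE.
  by case: ifP => rh; rewrite !mxE // /f_coord.
rewrite addsmx_sub; apply/andP; split.
  apply/tower_subP => j jh; apply/row_subP => i.
  have jh' : (j < h.+1)%N by rewrite ltnW.
  by have := row_sub (mxvec_index (Ordinal jh') i) M; rewrite rowM /= jh.
apply/row_subP => i.
by have := row_sub (mxvec_index ord_max i) M; rewrite rowM /= ltnn.
Qed.

End HyperplaneSections.

(** * Weights of the direct sum and of V *)

Section Weights.
Variables (F : finFieldType) (L : fieldExtType F).

Lemma max_meet_lt k (W : {vspace {ffun 'I_k -> L}}) r b :
    (0 < b)%N ->
    (forall H : {vspace 'rV[L]_k}, \dim H = r -> (\dim (W :&: restrict H) < b)%N) ->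
  (max_meet W r < b)%N.
Proof.
move=> b0 bH; rewrite -[b]prednK // ltnS; apply/bigmax_leqP => d /asboolP[H Hr <-].
by rewrite -ltnS prednK // bH.
Qed.

Lemma leq_max_meet k (W : {vspace {ffun 'I_k -> L}}) (H : {vspace 'rV[L]_k}) :
  (\dim (W :&: restrict H) <= max_meet W (\dim H))%N.
Proof.
have dW : (\dim (W :&: restrict H) < (\dim W).+1)%N by rewrite ltnS dimvS // capvSl.
apply: (leq_bigmax_cond (Ordinal dW)).
by apply/asboolP; exists H.
Qed.

Section Blocks.
Variables (m l : nat) (U : 'I_m -> {vspace {ffun 'I_l -> L}}) (N : nat).
Hypothesis dimU : forall j, (\dim (U j) <= N)%N.

Lemma system_weight_block_sum s :
  (s <= m)%N -> (system_weight (block_sum U) (s * l) <= s * N)%N.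
Proof.
move=> sm; set r := (m - s)%N.
(* [g] fills the first r blocks and puts 0 in the others. *)
pose g (B : 'M[L]_(r, l)) : 'rV[L]_(m * l) := mxvec (pid_mx r *m B : 'M_(m, l)).
have g_lin : linear g.
  by move=> a B B'; rewrite /g mulmxDr -scalemxAr linearP.
pose gL := GRing.isLinear.Build _ _ _ _ g g_lin.
pose gH : {linear 'M[L]_(r, l) -> 'rV[L]_(m * l)} := HB.pack g gL.
have gI : injective (linfun gH).
  move=> B B'; rewrite !lfunE /= => /(can_inj mxvecK).
  have e : (pid_mx r : 'M[L]_(r, m)) *m (pid_mx r : 'M[L]_(m, r)) = 1%:M.
    by rewrite mul_pid_mx minnn (minn_idPr _) ?leq_subr // pid_mx_1.
  by move/(congr1 (mulmx (pid_mx r : 'M_(r, m)))); rewrite !mulmxA e !mul1mx.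
pose H := limg (linfun gH).
have dH : \dim H = (m * l - s * l)%N.
  by rewrite dim_img_inj // dimvf /dim /= -mulnBl.
pose U1 := (\sum_(j < m | (j < r)%N) linfun (in_block j) @: U j)%VS.
pose U2 := (\sum_(j < m | ~~ (j < r)%N) linfun (in_block j) @: U j)%VS.
have U12 : block_sum U = (U1 + U2)%VS by rewrite /block_sum (bigID (fun j : 'I_m => (j < r)%N)).
have U1H : (U1 <= block_sum U :&: restrict H)%VS.
  rewrite subv_cap {1}U12 addvSl; apply/subv_sumP => j jr.
  apply/subvP => _ /memv_imgP[u _ ->]; rewrite mem_restrict lfunE /= of_rowK.
  apply/memv_imgP; exists (\matrix_(i, c) if i == j :> nat then u c else 0); first exact: memvf.
  rewrite lfunE /= /g; congr mxvec; apply/matrixP => i c; rewrite !mxE.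
  have [ir|ri] := ltnP i r.
    rewrite (bigD1 (Ordinal ir)) //= big1 ?addr0 => [|k]; rewrite !mxE /=.
      by rewrite eqxx ir mul1r.
    by rewrite -val_eqE /= eq_sym => /negbTE->; rewrite mul0r.
  rewrite big1 => [|k _]; first by case: eqP ri => // ->; rewrite leqNgt jr.
  by rewrite mxE ltnNge ri andbF mul0r.
have dU2 : (\dim U2 <= s * N)%N.
  apply: leq_trans (dimv_leq_sum _ _ _) _.
  apply: (@leq_trans (\sum_(j < m | ~~ (j < r)%N) N)); last first.
    under eq_bigl do rewrite -leqNgt.
    rewrite -(big_geq_mkord r m xpredT (fun=> N)) sum_nat_const_nat.
    by rewrite leq_mul2r subKn // leqnn orbT.
  apply: leq_sum => j _; apply: leq_trans (dimU j).
  by rewrite -[leqRHS](limg_ker_dim (linfun (in_block j)) (U j)) leq_addl.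
rewrite /system_weight -dH leq_subLR; apply: leq_trans (leq_add (leq_max_meet _ _) dU2).
rewrite U12; apply: leq_trans (dimv_add_leqif _ _) _; rewrite leq_add2r -U12.
exact: dimvS.
Qed.

End Blocks.

Section Family.
Variables (m h : nat) (A : {ffun 'I_m -> L}).

Local Notation n := (\dim {:L}).
Local Notation V := (V_space A h).

Lemma dim_V_space : (0 < h)%N -> \dim V = (m * n)%N.
Proof.
move=> h0; rewrite dim_img_inj ?dimvf /dim /= ?card_ord // => x y.
rewrite !lfunE => exy; apply/ffunP => i.
have := congr1 (fun v : {ffun _ -> L} => v (mxvec_index ord0 i)) exy.
by rewrite !ffunE !mxvecE !mxE h0 !expr1.
Qed.

Lemma tower1_leq w (X : 'M[L]_(m, w)) : (\rank (tower X 1) <= m)%N.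
Proof.
by rewrite tower_recr /tower big_ord0 adds0mx genmxE rank_leq_row.
Qed.

Lemma tower0 w (X : 'M[L]_(m, w)) : \rank (tower X 0) = 0%N.
Proof. by rewrite /tower big_ord0 mxrank0. Qed.

Hypothesis A0 : forall i, A i != 0.

(** The section by the span H is V itself, of dimension mn. As D 1 <= m, the ranks are D k = mk, and
    [rank_tower_f_mx] yields dim H >= m(h + 1). *)
Lemma ext_span_V_space : (0 < h)%N -> (h.+1 < n)%N -> ext_span V = fullv.
Proof.
move=> h0 hn; set H := ext_span V.
have VH : (V :&: restrict H)%VS = V.
  apply/capv_idPl/subvP => v vV; rewrite mem_restrict.
  rewrite (coord_vbasis vV) (_ : to_row _ =
    \sum_(i < \dim V) (coord (vbasis V) i v)%:A *: to_row (vbasis V)`_i); last first.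
    apply/rowP=> p; rewrite !mxE summxE sum_ffunE; apply: eq_bigr => i _.
    by rewrite !mxE !ffunE mulr_algl.
  apply: memv_suml => i _; apply: memvZ; apply: memv_span; apply: map_f.
  by rewrite mem_nth // size_tuple.
have [X [freeX rX]] := section_matrix A H.
have cX := tower_concave X; have D0 := tower0 X.
have Dn : (m * n <= \rank (tower X n))%N by rewrite rank_tower_dim // VH dim_V_space.
have lin := concave_linear cX D0 Dn (tower1_leq X).
have := leq_trans (rank_tower_f_mx h X A0) (leq_add (leqnn _) rX).
rewrite !lin //; [|lia..] => le; apply/eqP; rewrite eqEdim subvf dimvf /dim /= mul1n.
by move: le; rewrite -/H; lia.
Qed.

(** Each alternative in the hypothesis bounds the increment of D at h as [concave_extremal]
    requires. *)
Lemma V_space_meet r s (H : {vspace 'rV[L]_(h.+1 * m)}) :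
    (2 <= h)%N -> (r + s = m)%N -> (0 < s)%N ->
    (r = 1%N /\ h.+2 < n)%N \/ ((s + 1) * (h + 1) < n)%N ->
    \dim H = (r * h.+1)%N -> (r * n <= \dim (V :&: restrict H))%N ->
  exists w (Y : 'M[L]_(w, m)), \rank Y = r /\ twist_stable A Y.
Proof.
move=> h2 rs s0 hn dH rn.
have [X [freeX rX]] := section_matrix A H.
have cX := tower_concave X; have D0 := tower0 X; have D1 := tower1_leq X.
have Dn : (r * n <= \rank (tower X n))%N by rewrite rank_tower_dim.
have fX := leq_trans (rank_tower_f_mx h X A0) (leq_add (leqnn _) rX).
have h0 : (0 < h)%N by apply: leq_trans h2.
have h1n : (h.+1 < n)%N by case: hn; nia.
have lin k : (k <= n)%N -> \rank (tower X k) = (r * k)%N.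
  move: k; apply: (concave_extremal cX D0 h0 h1n Dn _ fX); first by rewrite dH.
  case: hn => [[r1 hn]|hn].
    (* Monotonicity and [fX] give D h <= h + 1; the increment at h is at most D h / h, hence at most
       1 as h >= 2. *)
    have low := concave_lower cX 0 h; rewrite add0n D0 addn0 in low.
    have mono : (\rank (tower X h.+1) <= \rank (tower X h.+2))%N.
      by rewrite mxrankS // [X in (_ <= X)%MS]tower_recr addsmxSl.
    rewrite dH r1 in fX *; nia.
  (* The increment at h is at most D 1 <= r + s, and s < n - h - 2. *)
  have := concave_slope cX (leq0n h); rewrite D0; nia.
exists _, (map_mx (frob h) X)^T; split.
  rewrite mxrank_tr mxrank_map -(mxrank_map (frob 0)).
  have := lin 1%N (ltnW (ltnW (leq_trans _ h1n))).
  by rewrite tower_recr /tower big_ord0 adds0mx genmxE muln1; apply; lia.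
apply: (@twist_stable_frob _ _ _ _ _ _ _ r) => [k kh|]; first by rewrite lin //; lia.
by rewrite -dH.
Qed.

Lemma V_space_weight r s :
    (2 <= h)%N -> (r + s = m)%N -> (0 < s)%N ->
    (r = 1%N /\ h.+2 < n)%N \/ ((s + 1) * (h + 1) < n)%N -> (0 < r)%N ->
    (forall w (Y : 'M[L]_(w, m)), \rank Y = r -> ~ twist_stable A Y) ->
  (s * n < system_weight V (s * (h + 1)))%N.
Proof.
move=> h2 rs s0 hn r0 noY.
have n0 : (0 < n)%N by case: hn; lia.
have e : (h.+1 * m - s * (h + 1) = r * h.+1)%N by rewrite -rs; nia.
rewrite /system_weight e dim_V_space ?(ltnW h2) //.
have : (m * n = r * n + s * n)%N by rewrite -mulnDl rs.
have : (max_meet V (r * h.+1) < r * n)%N.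
  apply: max_meet_lt => [|H dH]; first by rewrite muln_gt0 r0.
  rewrite ltnNge; apply/negP => rn.
  by have [w [Y [rY /noY]]] := V_space_meet h2 rs s0 hn dH rn; apply.
lia.
Qed.

End Family.
End Weights.

Theorem theorem4p8 (F : finFieldType) (L : fieldExtType F) (n m h : nat)
  (Ln : \dim {:L} = n) (m_ge3 : (3 <= m)%N)
  (h_ge2 : (2 <= h)%N) (h_le : (h <= n - 3)%N)
  (U : 'I_m -> {vspace {ffun 'I_h.+1 -> L}})
  (U_max : forall j, maximum_scattered h (U j))
  (U_scattered : scattered h (block_sum U))
  (C : {vspace 'rV[L]_(\dim (block_sum U))})
  (C_code : associated_code (block_sum U) C) :
  [/\ forall s : nat, (2 <= s <= m - 2)%N -> ((s + 1) * (h + 1) < n)%N ->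
        forall A : {ffun 'I_m -> L}, in_calB A ->
        forall G : {vspace 'rV[L]_(\dim (V_space A h))},
          associated_code (V_space A h) G ->
        (gen_rank_weight C (s * (h + 1)) < gen_rank_weight G (s * (h + 1)))%N,
      (2 * h + 2 < n)%N ->
        forall A : {ffun 'I_m -> L}, in_calA A ->
        forall G : {vspace 'rV[L]_(\dim (V_space A h))},
          associated_code (V_space A h) G ->
        (gen_rank_weight C (h + 1) < gen_rank_weight G (h + 1))%N
    & forall A : {ffun 'I_m -> L}, in_calA A ->
        forall G : {vspace 'rV[L]_(\dim (V_space A h))},
          associated_code (V_space A h) G ->
        (gen_rank_weight C ((m - 1) * (h + 1))
           < gen_rank_weight G ((m - 1) * (h + 1)))%N].
Proof.
(* As h >= 2, the subtraction n - 3 is not truncated. *)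
have h2n : (h.+2 < n)%N by move: h_le h_ge2; lia.
have dimU j : (\dim (U j) <= n)%N.
  by have [_ /eqP] := U_max j; rewrite mulnC eqn_pmul2l // Ln => /eqP->.
have weightC s : (s <= m)%N -> (gen_rank_weight C (s * (h + 1)) <= s * n)%N.
  move=> sm; case: U_scattered => spanU _.
  by rewrite (gen_rank_weightE _ spanU C_code) addn1 system_weight_block_sum.
have weightG r s A (G : {vspace 'rV[L]_(\dim (V_space A h))}) :
    in_calA A -> associated_code (V_space A h) G ->
    (r + s = m)%N -> (0 < r)%N -> (0 < s)%N ->
    (r = 1%N /\ h.+2 < n)%N \/ ((s + 1) * (h + 1) < n)%N ->
    (forall w (Y : 'M[L]_(w, m)), \rank Y = r -> ~ twist_stable A Y) ->
  (gen_rank_weight C (s * (h + 1)) < gen_rank_weight G (s * (h + 1)))%N.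
  move=> [A0 _] AG rs r0 s0 hn noY; apply: leq_ltn_trans (weightC s _) _; first by lia.
  rewrite (gen_rank_weightE _ _ AG); last by apply: ext_span_V_space => //; rewrite ?Ln; lia.
  by rewrite -Ln in hn *; apply: (V_space_weight A0 _ rs).
split=> [s sm hs A AB G AG|hn A AA G AG|A AA G AG].
(* Here 2 <= r <= m - 2, so Y is neither zero nor full; the ordinal 1 is the index of Pi_2. *)
- have [AA noPi] := AB; have [A0 _] := AA.
  apply: (@weightG (m - s)%N) => //; [lia|lia|lia|by right|] => w Y rY stY.
  have Y0 : Y != 0 by rewrite -mxrank_eq0 rY; lia.
  have nfY : ~~ row_full Y by rewrite /row_full rY; lia.
  have m1 : (1 < m)%N by lia.
  have [d dm dP] := stable_Pi_ratio A0 stY (Ordinal m1) Y0 nfY.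
  exact: noPi dP.
(* Here s = 1, r = m - 1 and (s + 1)(h + 1) = 2h + 2. *)
- rewrite -[(h + 1)%N]mul1n; have [A0 noK] := AA.
  apply: (@weightG (m - 1)%N) => //; [lia|lia|by right; lia|] => w Y rY stY.
  by apply/noK/(stable_hyperplane_K_prod A0 stY); rewrite ?rY ?subn1 //; lia.
- have [A0 noK] := AA.
  apply: (@weightG 1%N) => //; [lia|lia|by left|] => w Y rY stY.
  exact/noK/(stable_line_K_prod A0 stY).
Qed.
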